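(* Let $S\in\mathbb R^{q\times q}$ and, for $i=1,\dots,N$, let $A_i\in\mathbb R^{n_i\times n_i}$, $B_i\in\mathbb R^{n_i\times m_i}$, $C_i\in\mathbb R^{m_i\times n_i}$, $D_i\in\mathbb R^{m_i\times m_i}$, $E_i\in\mathbb R^{n_i\times q}$, $F_i\in\mathbb R^{m_i\times q}$. Assume that, for $i=1,\dots,N$, the linear matrix equations $$X_iS=A_iX_i+B_iU_i+E_i,\qquad 0=C_iX_i+D_iU_i+F_i$$ have a unique solution pair $(X_i,U_i)$, $X_i\in\mathbb R^{n_i\times q}$, $U_i\in\mathbb R^{m_i\times q}$. Let $S_i(t)$, $i=1,\dots,N$, be generated by $$S_i(t+1)=S_i(t)+\mu_1\sum_{j=0}^Na_{ij}(S_j(t)-S_i(t)),\qquad S_0(t)=S,$$ with arbitrary initial values $S_i(0)\in\mathbb R^{q\times q}$, where $[a_{ij}]_{i,j=0}^N$ is the weighted adjacency matrix of a directed graph $\bar{\mathcal G}$ on the nodes $\{0,1,\dots,N\}$ that contains a spanning tree with node $0$ as the root, and $0<\mu_1<\frac{2}{\rho(H)}$. Then, for $i=1,\dots,N$, for any initial condition $\zeta_i(0)\in\mathbb R^{q(n_i+m_i)}$, the equation $$\zeta_i(t+1)=\zeta_i(t)-\mu_{3i}G_i(t)^T(G_i(t)\zeta_i(t)-b_i),$$ where $0<\mu_{3i}<\frac{2}{\rho(Q_i^TQ_i)}$, has a bounded solution for all $t\in\mathbb Z^+$. Moreover, let $\Xi_i(t)=M^q_{n_i+m_i}(\zeta_i(t))$.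 Then $$\lim_{t\to\infty}\left(\Xi_i(t)-\begin{bmatrix}X_i \\ U_i\end{bmatrix}\right)=0$$ exponentially.
   Context: $\mathbb Z^+$ is the set of nonnegative integers. For a square matrix $A$ with spectrum $\sigma(A)$, $\rho(A)=\max_{\lambda\in\sigma(A)}\frac{|\lambda|^2}{\mathrm{Re}(\lambda)}$ (this is not the spectral radius in general). $\otimes$ is the Kronecker product. $\mathrm{vec}(A)$ is the column vector obtained by stacking the columns of $A$; for $X=\mathrm{col}(X_1,\dots,X_q)\in\mathbb R^{nq}$ with $X_k\in\mathbb R^n$, $M^q_n(X)=[X_1\ \cdots\ X_q]\in\mathbb R^{n\times q}$. Convergence of $y(t)$ to $0$ is exponential if $\|y(t)\|\le c\,\alpha^t$ for all $t\ge0$ for some $c>0$, $0<\alpha<1$ (the constants may depend on the trajectory). Graph: $a_{ii}=0$, $a_{ij}>0$ if $(j,i)$ is an edge of $\bar{\mathcal G}$, and $a_{ij}=0$ otherwise. A spanning tree rooted at $0$ means that every other node is reachable from $0$ by a directed path. $H=[h_{ij}]\in\mathbb R^{N\times N}$ ($i,j=1,\dots,N$) with $h_{ii}=\sum_{j=0}^Na_{ij}$ and $h_{ij}=-a_{ij}$ for $i\ne j$. For $i=1,\dots,N$: $$b_i=\mathrm{vec}\begin{bmatrix}E_i \\ F_i\end{bmatrix},\quad Q_i=S^T\otimes\begin{bmatrix}I_{n_i}&0 \\ 0&0\end{bmatrix}-I_q\otimes\begin{bmatrix}A_i&B_i \\ C_i&D_i\end{bmatrix},\quad G_i(t)=S_i(t)^T\otimes\begin{bmatrix}I_{n_i}&0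 \\ 0&0\end{bmatrix}-I_q\otimes\begin{bmatrix}A_i&B_i \\ C_i&D_i\end{bmatrix}.$$ *)

(* Defs.v *)
From mathcomp Require Import all_boot all_order all_algebra.
From mathcomp Require Import all_classical all_reals all_analysis.
From mathcomp Require Import complex mxtens.

Set Implicit Arguments.
Unset Strict Implicit.
Unset Printing Implicit Defensive.

Import Order.TTheory GRing.Theory Num.Theory.
Import numFieldNormedType.Exports.

Local Open Scope classical_set_scope.
Local Open Scope ring_scope.

(* Complex spectrum of a real square matrix. *)
Definition spectrum (R : realType) (n : nat) (A : 'M[R]_n) : set R[i] :=
  [set l | eigenvalue (map_mx (real_complex R) A) l].

(* max of |l|^2 / Re l over the spectrum; the spectrum is finite, so this
   supremum is a maximum as soon as 0 < n. *)
Definition rho (R : realType) (n : nat) (A : 'M[R]_n) : R :=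
  sup [set Normc.normc l ^+ 2 / complex.Re l | l in spectrum A].

(* Column stacking: coordinate k * n + i is entry (i, k). The indexing
   [mxtens_index] is the one used by the Kronecker product [tensmx]; [mxvec]
   would stack rows instead. *)
Definition vec (R : realType) (n q : nat) (A : 'M[R]_(n, q)) : 'cV[R]_(q * n) :=
  \col_r A (mxtens_unindex r).2 (mxtens_unindex r).1.

Definition unvec (R : realType) (n q : nat) (x : 'cV[R]_(q * n)) : 'M[R]_(n, q) :=
  \matrix_(i, k) x (mxtens_index (k, i)) 0.

(* [e j i] is the directed edge (j, i), contributing to row i of [a]. *)
Definition weighted_adjacency (R : realType) (N : nat) (e : rel 'I_N.+1)
    (a : 'M[R]_N.+1) : Prop :=
  (forall i, a i i = 0) /\
  (forall i j, (e j i -> 0 < a i j) /\ (~~ e j i -> a i j = 0)).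

Definition has_spanning_tree0 (N : nat) (e : rel 'I_N.+1) : Prop :=
  forall i : 'I_N.+1, i != ord0 -> connect e ord0 i.

(* Nodes 1, ..., N are encoded as [lift ord0 i] with i : 'I_N. *)
Definition Hmx (R : realType) (N : nat) (a : 'M[R]_N.+1) : 'M[R]_N :=
  \matrix_(i, j)
    (if i == j then \sum_(k < N.+1) a (lift ord0 i) k
     else - a (lift ord0 i) (lift ord0 j)).

(* Q_i is [regulator_mx S A_i B_i C_i D_i], and G_i(t) is
   [regulator_mx S_i(t) A_i B_i C_i D_i]. *)
Definition regulator_mx (R : realType) (q n m : nat) (S : 'M[R]_q)
    (A : 'M[R]_n) (B : 'M[R]_(n, m)) (C : 'M[R]_(m, n)) (D : 'M[R]_m) :
    'M[R]_(q * (n + m)) :=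
  tensmx S^T (block_mx 1%:M 0 0 0) - tensmx 1%:M (block_mx A B C D).

Definition regulator_eqs (R : realType) (q n m : nat) (S : 'M[R]_q)
    (A : 'M[R]_n) (B : 'M[R]_(n, m)) (C : 'M[R]_(m, n)) (D : 'M[R]_m)
    (E : 'M[R]_(n, q)) (F : 'M[R]_(m, q))
    (XU : 'M[R]_(n, q) * 'M[R]_(m, q)) : Prop :=
  XU.1 *m S = A *m XU.1 + B *m XU.2 + E /\
  0 = C *m XU.1 + D *m XU.2 + F.

(* The norm is the max-entry norm; the choice only affects the constant c. *)
Definition exp_cvg0 (R : realType) (m n : nat) (y : nat -> 'M[R]_(m, n)) : Prop :=
  y @ \oo --> (0 : 'M[R]_(m, n)) /\
  exists c alpha : R, [/\ 0 < c, 0 < alpha < 1 &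
    forall t : nat, `|y t| <= c * alpha ^+ t].

(* Main.v *)
(** A matrix whose complex eigenvalues all lie in the open unit disc has
exponentially decaying powers: by Cayley-Hamilton each entry of its powers is
annihilated by a product of operators u |-> u(t+1) - l u(t) with |l| < 1. If all
eigenvalues l of A have positive real part, then 0 < mu < 2 / rho(A) says exactly
that |1 - mu l| < 1 for each of them. This applies to H, which is weakly
diagonally dominant and, thanks to the paths from the root, has no eigenvalue on
or left of the imaginary axis; and to Q^T Q, which is positive definite because
unique solvability of the regulator equations makes Q invertible. Hence G(t) -> Q exponentially, and the error zeta(t) - Q^-1 b follows
an exponentially stable recursion with exponentially vanishing perturbation. *)
Require Import Defs.
From mathcomp Require Import all_boot all_order all_algebra.
From mathcomp Require Import all_classical all_reals all_analysis.
From mathcomp Require Import complex mxtens.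
From mathcomp Require Import ring lra.
Import Order.TTheory GRing.Theory Num.Theory.
Import numFieldNormedType.Exports.
Local Open Scope ring_scope.

Set Implicit Arguments.
Unset Strict Implicit.
Unset Printing Implicit Defensive.

(** * Sequences dominated by a decaying geometric sequence *)

(** The bound is one-sided, so that it passes to any smaller sequence; in the convergence results it
    is applied to norms. *)
Definition geo_bounded (R : realType) (u : nat -> R) : Prop :=
  exists c r : R, [/\ 0 < c, 0 < r < 1 & forall t : nat, u t <= c * r ^+ t].

Lemma geo_le (R : realType) (u v : nat -> R) :
  (forall t, u t <= v t) -> geo_bounded v -> geo_bounded u.
Proof.
move=> uv [c [r [c0 r01 vb]]]; exists c, r; split=> // t.
exact: le_trans (uv t) (vb t).
Qed.

Lemma geo0 (R : realType) : geo_bounded (fun=> 0 : R).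
Proof.
by exists 1, 2^-1; split => //; lra.
Qed.

Lemma geo_widen (R : realType) (c c' r r' : R) (t : nat) :
  0 <= c <= c' -> 0 <= r <= r' -> c * r ^+ t <= c' * r' ^+ t.
Proof.
move=> /andP[c0 cc'] /andP[r0 rr'].
apply: ler_pM => //; first exact: exprn_ge0.
by apply: lerXn2r => //; rewrite nnegrE// (le_trans r0).
Qed.

Lemma geo_add (R : realType) (u v : nat -> R) :
  geo_bounded u -> geo_bounded v -> geo_bounded (fun t => u t + v t).
Proof.
move=> [c [r [c0 /andP[r0 r1] ub]]] [d [s [d0 /andP[s0 s1] vb]]].
pose m := Num.max r s; have rm : r <= m by rewrite le_max lexx.
have sm : s <= m by rewrite le_max lexx orbT.
exists (c + d), m; split; first exact: addr_gt0.
  by rewrite /m lt_max r0 gt_max r1 s1.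
move=> t; rewrite mulrDl lerD//.
  by apply: (le_trans (ub t)); apply: geo_widen; rewrite ?lexx ?rm ltW.
by apply: (le_trans (vb t)); apply: geo_widen; rewrite ?lexx ?sm ltW.
Qed.

Lemma geo_scale (R : realType) (k : R) (u : nat -> R) :
  0 <= k -> geo_bounded u -> geo_bounded (fun t => k * u t).
Proof.
move=> k0 [c [r [c0 r01 ub]]]; exists (k * c + 1), r; split=> //.
  by rewrite ltr_wpDl// mulr_ge0// ltW.
move=> t; apply: (le_trans (ler_wpM2l k0 (ub t))).
case/andP: r01 => r0 _; rewrite mulrA ler_wpM2r ?exprn_ge0 ?(ltW r0)//.
by rewrite lerDl.
Qed.

Lemma geo_sum (R : realType) (I : Type) (s : seq I) (F : I -> nat -> R) :
  (forall i, geo_bounded (F i)) -> geo_bounded (fun t => \sum_(i <- s) F i t).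
Proof.
move=> gF; elim: s => [|i s IH].
  by apply: geo_le (@geo0 R) => t; rewrite big_nil.
by apply: geo_le (geo_add (gF i) IH) => t; rewrite big_cons.
Qed.

Lemma geo_shift (R : realType) (T : nat) (u : nat -> R) :
  geo_bounded (fun t => u (T + t)%N) -> geo_bounded u.
Proof.
elim: T u => [|T IH] u; first by [].
move=> gu; have {}gu : geo_bounded (fun t => u t.+1) by apply: IH.
case: gu => c [r [c0 /andP[r0 r1] ub]].
exists (c / r + `|u 0%N|), r; split; [|by rewrite r0 |].
  by rewrite ltr_pwDl// divr_gt0.
case=> [|t].
  by rewrite expr0 mulr1; apply: (le_trans (ler_norm _)); rewrite lerDr divr_ge0// ltW.
apply: (le_trans (ub t)); rewrite mulrDl exprS mulrA divfK ?gt_eqF// lerDl.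
by rewrite !mulr_ge0// ?exprn_ge0// ltW.
Qed.

(** For a rate d with max(a, r) < d < 1, the constant K = |u 0| + c / (d - a) satisfies a K + c <= d
    K, which closes the induction. *)
Lemma geo_rec (R : realType) (a : R) (u f : nat -> R) :
  0 <= a < 1 -> geo_bounded f -> (forall t, u t.+1 <= a * u t + f t) ->
  geo_bounded u.
Proof.
move=> /andP[a0 a1] [c [r [c0 /andP[r0 r1] fb]]] urec.
pose m := Num.max a r; have am : a <= m by rewrite le_max lexx.
have rm : r <= m by rewrite le_max lexx orbT.
have m1 : m < 1 by rewrite gt_max a1 r1.
(* The midpoint of m and 1 keeps d - a positive, also in the resonant case a = r. *)
pose d := (1 + m) / 2.
have md : m < d by rewrite /d; lra.
have d1 : d < 1 by rewrite /d; lra.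
have ad : 0 < d - a by lra.
exists (`|u 0%N| + c / (d - a)), d; split; first by rewrite ltr_wpDl// divr_gt0.
  by apply/andP; split => //; lra.
elim=> [|t IH].
  by rewrite expr0 mulr1 (le_trans (ler_norm _))// lerDl divr_ge0// ltW.
apply: (le_trans (urec t)).
have dt : 0 <= d ^+ t by rewrite exprn_ge0//; lra.
have ft : f t <= c * d ^+ t.
  by apply: (le_trans (fb t)); apply: geo_widen; apply/andP; split=> //; lra.
apply: (le_trans (lerD (ler_wpM2l a0 IH) ft)).
rewrite exprS mulrA mulrA -mulrDl ler_wpM2r// -subr_ge0.
have -> : (`|u 0%N| + c / (d - a)) * d - (a * (`|u 0%N| + c / (d - a)) + c)
  = `|u 0%N| * (d - a) + (c / (d - a) * (d - a) - c) by ring.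
by rewrite divfK ?gt_eqF// subrr addr0 mulr_ge0// ltW.
Qed.

Lemma geo_eventually_le (R : realType) (u : nat -> R) (eps : R) :
  geo_bounded u -> 0 < eps -> exists T, forall t, u (T + t)%N <= eps.
Proof.
move=> [c [r [c0 /andP[r0 r1] ub]]] e0.
have : (geometric c r x @[x --> \oo] --> (0:R))%classic.
  by apply: cvg_geometric; rewrite gtr0_norm.
move/cvgr0_norm_le => /(_ _ e0)[T _ hT]; exists T => t.
apply: (le_trans (ub _)); apply: le_trans (hT (T + t)%N _) => /=.
  exact: ler_norm.
exact: leq_addr.
Qed.

(** From some time T on, f is at most (1 - a) / 2, so the factor is at most (1 + a) / 2 < 1 and
    [geo_rec] applies to the tail. *)
Lemma geo_rec_perturbed (R : realType) (a : R) (u f : nat -> R) :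
  0 <= a < 1 -> (forall t, 0 <= u t) -> geo_bounded f ->
  (forall t, u t.+1 <= (a + f t) * u t + f t) -> geo_bounded u.
Proof.
move=> /andP[a0 a1] u0 gf urec.
have [T hT] : exists T, forall t, f (T + t)%N <= (1 - a) / 2.
  by apply: geo_eventually_le => //; lra.
apply: (@geo_shift R T); apply: (@geo_rec R ((1 + a) / 2) _ (fun t => f (T + t)%N)).
- by apply/andP; split; lra.
- case: gf => c [r [c0 r01 fb]]; exists (c * r ^+ T), r; split=> //.
    by case/andP: r01 => r0 _; rewrite mulr_gt0// exprn_gt0.
  by move=> t; rewrite -mulrA -exprD.
move=> t; rewrite addnS; apply: (le_trans (urec _)).
by rewrite lerD2r ler_wpM2r//; have := hT t; lra.
Qed.

Lemma geo_cvg0 (R : realType) (m n : nat) (y : nat -> 'M[R]_(m, n)) :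
  geo_bounded (fun t => `|y t|) -> exp_cvg0 y.
Proof.
move=> gy; split=> //; apply/norm_cvg0P.
case: (gy) => c [r [c0 /andP[r0 r1] ub]].
apply: (@squeeze_cvgr _ _ _ _ (fun=> 0) (geometric c r)).
- by apply: nearW => t; rewrite normr_ge0 ub.
- exact: cvg_cst.
by apply: cvg_geometric; rewrite gtr0_norm.
Qed.

(** * Complex spectra and decay of matrix powers *)

Lemma normc_real_complex (R : realType) (x : R) :
  Normc.normc (real_complex R x) = `|x|.
Proof. by rewrite /= expr0n addr0 sqrtr_sqr. Qed.

Lemma normcE2 (R : realType) (x : R[i]) :
  Normc.normc x ^+ 2 = complex.Re x ^+ 2 + complex.Im x ^+ 2.
Proof. by case: x => a b /=; rewrite sqr_sqrtr// addr_ge0// sqr_ge0. Qed.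

Lemma normc_ge0 (R : realType) (x : R[i]) : 0 <= Normc.normc x.
Proof. by case: x => a b; exact: sqrtr_ge0. Qed.

(* Multiplying [p] by ['X - r] turns the sequence u of entries into
   u (t + 1) - r u t, so roots can be stripped off one at a time. *)
Lemma geo_horner_mx (R : realType) (n : nat) (A : 'M[R[i]]_n.+1) (i j : 'I_n.+1)
    (rs : seq R[i]) (p : {poly R[i]}) :
  all (fun r => Normc.normc r < 1) rs ->
  horner_mx A (p * \prod_(r <- rs) ('X - r%:P)) = 0 ->
  geo_bounded (fun t => Normc.normc (horner_mx A (p * 'X^t) i j)).
Proof.
elim: rs p => [|r rs IH] p /=.
  rewrite big_nil mulr1 => _ p0; apply: geo_le (@geo0 R) => t.
  by rewrite rmorphM /= p0 mul0r mxE Normc.normc0.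
move=> /andP[r1 rs1]; rewrite big_cons mulrA => /(IH _ rs1) gv.
apply: (geo_rec (a := Normc.normc r) _ gv); first by rewrite normc_ge0.
move=> t; rewrite -Normc.normcM -[X in X <= _]/(Normc.normc _).
have -> : horner_mx A (p * 'X^(t.+1)) i j =
    r * horner_mx A (p * 'X^t) i j + horner_mx A (p * ('X - r%:P) * 'X^t) i j.
  have -> : p * 'X^(t.+1) = r *: (p * 'X^t) + p * ('X - r%:P) * 'X^t.
    by rewrite -mul_polyC exprS; ring.
  by rewrite linearD linearZ /= !mxE.
exact: le_normcD.
Qed.

(** The roots of the characteristic polynomial form the spectrum, so Cayley-Hamilton gives the
    hypothesis of [geo_horner_mx] with p = 1. *)
Lemma geo_power (R : realType) (n : nat) (M : 'M[R]_n) (i j : 'I_n) :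
  (forall l, spectrum M l -> Normc.normc l < 1) ->
  geo_bounded (fun t => `|(M ^+ t) i j|).
Proof.
case: n M i j => [|n] M i j hM; first by case: i.
pose C := map_mx (real_complex R) M.
have [rs Crs] := closed_field_poly_normal (char_poly C).
move: Crs; rewrite (monicP (char_poly_monic C)) scale1r => Crs.
have rs1 : all (fun r => Normc.normc r < 1) rs.
  apply/allP => r rrs; apply: hM; rewrite /spectrum /= eigenvalue_root_char.
  by rewrite -/C Crs root_prod_XsubC.
have := @geo_horner_mx R n C i j rs 1 rs1; rewrite mul1r -Crs Cayley_Hamilton.
move=> /(_ erefl); apply: geo_le => t.
rewrite mul1r rmorphXn /= horner_mx_X /C -[map_mx _ M ^+ t](rmorphXn (map_mx (real_complex R))) /= mxE.
by rewrite normc_real_complex.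
Qed.

Lemma rho_ge (R : realType) (n : nat) (A : 'M[R]_n) (l : R[i]) :
  spectrum A l -> Normc.normc l ^+ 2 / complex.Re l <= rho A.
Proof.
move=> Al; pose f (l : R[i]) := Normc.normc l ^+ 2 / complex.Re l.
pose C := map_mx (real_complex R) A.
have [rs Crs] := closed_field_poly_normal (char_poly C).
move: Crs; rewrite (monicP (char_poly_monic C)) scale1r => Crs.
apply: (sup_upper_bound (E := [set f l | l in spectrum A]%classic)); last by exists l.
split; first by exists (f l), l.
(* [sup] dominates its set only if the set is bounded above; the finite list of roots provides a
   bound. *)
exists (\sum_(r <- rs) `|f r|) => _ [r Ar <-].
have rrs : r \in rs.
  by move: Ar; rewrite /spectrum /= eigenvalue_root_char -/C Crs root_prod_XsubC.
rewrite (big_rem r)//= (le_trans (ler_norm _))// lerDl.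
by apply: sumr_ge0.
Qed.

(** Here l = 1 - mu x with x in the spectrum of A, and |1 - mu x|^2 = 1 - mu (2 Re x - mu |x|^2).
    The bracket is positive because |x|^2 <= rho(A) Re x and mu rho(A) < 2. *)
Lemma gradient_step_spectrum (R : realType) (n : nat) (A : 'M[R]_n) (mu : R) (l : R[i]) :
  (forall l, spectrum A l -> 0 < complex.Re l) -> 0 < mu < 2 / rho A ->
  spectrum (1 - mu *: A) l -> Normc.normc l < 1.
Proof.
move=> ReA /andP[mu0 mu2] /eigenvalueP[v vl v0].
have muC0 : real_complex R mu != 0.
  by rewrite -(rmorph0 (real_complex R)) (inj_eq (@complexI R)) gt_eqF.
pose x := (1 - l) / real_complex R mu.
have Ax : spectrum A x.
  apply/eigenvalueP; exists v => //.
  move: vl; rewrite map_mxB map_mxZ map_mx1 mulmxBr mulmx1 -scalemxAr => vl.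
  apply: (scalerI muC0); rewrite scalerA mulrC /x divfK//.
  by rewrite scalerBl scale1r -vl opprB addrC subrK.
have lE : l = 1 - real_complex R mu * x by rewrite /x mulrC divfK// opprB addrC subrK.
have rx := rho_ge Ax; have Rx := ReA _ Ax.
have N0 : 0 <= Normc.normc x ^+ 2 by rewrite exprn_ge0// normc_ge0.
(* The interval for mu is nonempty, so 2 / rho(A) > 0; inverses preserve sign, with 0 inverted to
   0. *)
have rho0 : 0 < rho A.
  by have := lt_trans mu0 mu2; rewrite pmulr_rgt0 // invr_gt0.
have : mu * Normc.normc x ^+ 2 < 2 * complex.Re x.
  move: rx; rewrite ler_pdivrMr// => rx; move: mu2; rewrite ltr_pdivlMr// => mu2.
  apply: le_lt_trans (ler_wpM2l (ltW mu0) rx) _.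
  by rewrite mulrA ltr_pM2r.
rewrite normcE2 => h.
rewrite -(@ltr_pXn2r _ 2)// ?nnegrE ?normc_ge0// expr1n normcE2 lE.
case: x {Ax lE rx N0} Rx h => a b /= a0 h.
rewrite !(mul0r, mulr0, add0r, addr0, subr0, oppr0).
nra.
Qed.

Lemma geo_gradient_power (R : realType) (n : nat) (A : 'M[R]_n) (mu : R) (i j : 'I_n) :
  (forall l, spectrum A l -> 0 < complex.Re l) -> 0 < mu < 2 / rho A ->
  geo_bounded (fun t => `|((1 - mu *: A) ^+ t) i j|).
Proof.
move=> ReA hmu; apply: geo_power => l; exact: gradient_step_spectrum.
Qed.

(** * The max-entry norm and perturbed linear recursions *)

Lemma mx_norm_le (R : realType) (m n : nat) (A : 'M[R]_(m, n)) (c : R) :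
  0 <= c -> (forall i j, `|A i j| <= c) -> `|A| <= c.
Proof.
move=> c0 h; rewrite [`|A|]mx_normrE.
by elim/big_ind: _ => // x y xc yc; rewrite ge_max xc yc.
Qed.

Lemma entry_le_mx_norm (R : realType) (m n : nat) (A : 'M[R]_(m, n)) i j :
  `|A i j| <= `|A|.
Proof.
by rewrite [leRHS]mx_normrE; exact: (le_bigmax _ (fun ij => `|A ij.1 ij.2|) (i, j)).
Qed.

Lemma mx_norm_tr (R : realType) (m n : nat) (A : 'M[R]_(m, n)) : `|A^T| <= `|A|.
Proof. by apply: mx_norm_le => // i j; rewrite mxE entry_le_mx_norm. Qed.

(** Each entry of the product is a sum of n terms; this is the source of the factor n. *)
Lemma mx_normM (R : realType) (m n p : nat) (A : 'M[R]_(m, n)) (B : 'M[R]_(n, p)) :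
  `|A *m B| <= n%:R * (`|A| * `|B|).
Proof.
apply: mx_norm_le => [|i j]; first by rewrite !mulr_ge0.
rewrite mxE (le_trans (ler_norm_sum _ _ _))//.
rewrite -[n in n%:R]card_ord mulr_natl -sumr_const ler_sum// => k _.
by rewrite normrM ler_pM// entry_le_mx_norm.
Qed.

Lemma mx_norm_tens (R : realType) (m n p q : nat) (A : 'M[R]_(m, n)) (B : 'M[R]_(p, q)) :
  `|tensmx A B| <= `|A| * `|B|.
Proof.
apply: mx_norm_le => [|i j]; first by rewrite mulr_ge0.
by rewrite mxE normrM ler_pM// entry_le_mx_norm.
Qed.

Lemma geo_mx_norm (R : realType) (m n : nat) (A : nat -> 'M[R]_(m, n)) :
  (forall i j, geo_bounded (fun t => `|A t i j|)) -> geo_bounded (fun t => `|A t|).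
Proof.
move=> h; apply: geo_le (geo_sum (index_enum 'I_m)
  (fun i => geo_sum (index_enum 'I_n) (h i))) => t.
have nonneg s : 0 <= \sum_(j <- index_enum 'I_n) `|A t s j| by exact: sumr_ge0.
apply: mx_norm_le => [|i j]; first by exact: sumr_ge0.
rewrite (bigD1_seq i)//= ?index_enum_uniq ?mem_index_enum//.
rewrite (bigD1_seq j)//= ?index_enum_uniq ?mem_index_enum//.
by rewrite -addrA lerDl addr_ge0// sumr_ge0.
Qed.

(* [y] solves the scalar equation obtained by taking norms in the variation of
   constants formula, so that |M^k (e t)| <= a^k (y t) for all k at once. *)
Lemma geo_perturbed (R : realType) (n : nat) (M : 'M[R]_n)
    (e f : nat -> 'cV[R]_n) (phi : nat -> R) :
  (forall i j, geo_bounded (fun t => `|(M ^+ t) i j|)) ->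
  geo_bounded phi -> (forall t, 0 <= phi t) ->
  (forall t, e t.+1 = M *m e t + f t) ->
  (forall t, `|f t| <= phi t * (`|e t| + 1)) ->
  geo_bounded (fun t => `|e t|).
Proof.
move=> /geo_mx_norm [c0 [a [c00 /andP[a0 a1] Mb]]] gphi phi0 erec fb.
pose c := n%:R * c0 + 1.
have c1 : 0 < c by rewrite ltr_wpDl// mulr_ge0// ltW.
have Mx k (x : 'cV[R]_n) : `|M ^+ k *m x| <= c * a ^+ k * `|x|.
  apply: (le_trans (mx_normM _ _)); rewrite mulrA ler_wpM2r//.
  apply: (le_trans (ler_wpM2l _ (Mb k))); rewrite ?ler0n// mulrA.
  by rewrite ler_wpM2r ?exprn_ge0 ?(ltW a0)// lerDl.
clearbody c.
pose y := fix y t := if t is s.+1 then a * y s + c * (phi s * (`|e s| + 1)) else c * `|e 0%N|.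
have ye t : forall k, `|M ^+ k *m e t| <= a ^+ k * y t.
  elim: t => [|t IH] k; first by rewrite /= mulrCA mulrA Mx.
  rewrite erec mulmxDr mulmxA (le_trans (ler_normD _ _))//= mulrDr lerD//.
    by rewrite mulrA -exprSr; apply: le_trans (IH k.+1); rewrite exprSr.
  apply: le_trans (Mx k (f t)) _; rewrite mulrA [a ^+ k * c]mulrC ler_wpM2l//.
  by rewrite mulr_ge0 ?exprn_ge0// ltW.
have ey t : `|e t| <= y t by have := ye t 0%N; rewrite !expr0 mul1mx mul1r.
(* Replacing |e t| by y t in the recursion for y gives y(t+1) <= (a + c phi(t)) y(t) + c phi(t). *)
apply: (geo_le ey); apply: (geo_rec_perturbed (a := a) (f := fun t => c * phi t)).
- by rewrite ltW.
- by move=> t; exact: le_trans (ey t).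
- by apply: geo_scale => //; exact: ltW.
move=> t /=; rewrite mulrDl -addrA lerD2l mulrA -[X in _ <= _ + X]mulr1 -mulrDr ler_wpM2l//.
  by rewrite mulr_ge0// ltW.
by rewrite lerD2r.
Qed.

(** * Location of the spectra of H and of Gram matrices *)

(** [eigenvalue] refers to row eigenvectors; transposing gives the right eigenvectors used in the
    row argument for H. *)
Lemma eigenvalue_trmx (F : fieldType) (n : nat) (A : 'M[F]_n) (l : F) :
  eigenvalue A^T l = eigenvalue A l.
Proof.
rewrite !eigenvalue_root_char; congr (root _ l); rewrite /char_poly -det_tr.
by rewrite /char_poly_mx linearB /= tr_scalar_mx map_trmx trmxK.
Qed.

Lemma Re_le_normc (R : realType) (x : R[i]) : complex.Re x <= Normc.normc x.
Proof.
case: x => a b /=; apply: (le_trans (ler_norm a)).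
by rewrite -sqrtr_sqr ler_wsqrtr// lerDl sqr_ge0.
Qed.

Lemma normc_sum (R : realType) (I : Type) (s : seq I) (P : pred I) (F : I -> R[i]) :
  Normc.normc (\sum_(i <- s | P i) F i) <= \sum_(i <- s | P i) Normc.normc (F i).
Proof.
elim/big_ind2: _ => [|x a y b xa yb|//]; first by rewrite Normc.normc0.
by apply: le_trans (lerD xa yb); exact: le_normcD.
Qed.

(* Let v be a right eigenvector with Re l <= 0. Row i of H v = l v at a node
   where |v_i| is maximal gives sum_k a_ik (max - |v_k|) <= 0 with v_0 := 0, so
   all in-neighbours of i are maximal too; following the path from the root
   backwards makes 0 maximal. *)
Lemma spectrum_Hmx_gt0 (R : realType) (N : nat) (e : rel 'I_N.+1) (a : 'M[R]_N.+1)
    (l : R[i]) :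
  weighted_adjacency e a -> has_spanning_tree0 e ->
  spectrum (Hmx a) l -> 0 < complex.Re l.
Proof.
move=> [a0 ae] he; rewrite /spectrum /= -eigenvalue_trmx => /eigenvalueP[v vl vn0].
have a_ge0 i j : 0 <= a i j.
  by case: (boolP (e j i)) => eji; [exact/ltW/(ae i j).1 | rewrite (ae i j).2].
rewrite ltNge; apply/negP => l0.
(* The moduli of v, extended by 0 at the root. *)
pose w (k : 'I_N.+1) : R := if unlift ord0 k is Some j then Normc.normc (v 0 j) else 0.
have w0 : w ord0 = 0 by rewrite /w unlift_none.
have wS j : w (lift ord0 j) = Normc.normc (v 0 j) by rewrite /w liftK.
have [j0 vj0] : exists j, v 0 j != 0 by apply/rV0Pn.
have w_ge0 k : 0 <= w k.
  by rewrite /w; case: (unlift _ _) => // j; rewrite normc_ge0.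
pose i0 := [arg max_(k > ord0) w k]%O.
have wmax k : w k <= w i0 by rewrite /i0; case: arg_maxP => // i _; apply.
pose m := w i0.
have m0 : 0 < m.
  apply: lt_le_trans (wmax (lift ord0 j0)); rewrite wS lt_neqAle normc_ge0 andbT eq_sym.
  by apply: contra vj0 => /eqP/Normc.eq0_normc ->.
have back i j : e j i -> w i = m -> w j = m.
  case: (unliftP ord0 i) => [i'|] ->; last by rewrite w0 => _ m0'; rewrite -m0' ltxx in m0.
  move=> eji wi.
  have rowi : real_complex R (\sum_k a (lift ord0 i') k) * v 0 i' - l * v 0 i' =
      \sum_k real_complex R (a (lift ord0 i') (lift ord0 k)) * v 0 k.
    have /(congr1 (fun u : 'rV_N => u 0 i')) := vl; rewrite !mxE => <-.
    rewrite (bigD1 i')//= [in RHS](bigD1 i')//= !mxE eqxx a0 rmorph0 mul0r add0r.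
    rewrite [v 0 i' * _]mulrC opprD addrA subrr add0r -sumrN; apply: eq_bigr => k ki.
    by rewrite !mxE eq_sym (negPf ki) rmorphN mulrN opprK mulrC.
  have le1 : (\sum_k a (lift ord0 i') k) * m <= \sum_k a (lift ord0 i') k * w k.
    rewrite big_ord_recl [leRHS]big_ord_recl w0 mulr0 add0r -big_ord_recl.
    set s := \sum_k a _ k in rowi *.
    (* Since Re l <= 0, s <= Re (s - l) <= |s - l|. *)
    apply: (@le_trans _ _ (Normc.normc (real_complex R s * v 0 i' - l * v 0 i'))).
      rewrite -mulrBl Normc.normcM -wS wi ler_wpM2r ?(ltW m0)//.
      apply: le_trans (Re_le_normc _); case: l l0 {vl rowi} => x y /=; lra.
    rewrite rowi; apply: (le_trans (normc_sum _ _ _)); apply: ler_sum => k _.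
    by rewrite Normc.normcM normc_real_complex ger0_norm// wS.
  (* A sum of nonnegative terms that is at most 0: every term vanishes, and a positive weight on the
     edge (j, i) forces w j = m. *)
  have diff0 : \sum_k a (lift ord0 i') k * (m - w k) = 0.
    apply/eqP; rewrite eq_le sumr_ge0 ?andbT; last first.
      by move=> k _; rewrite mulr_ge0// subr_ge0 wmax.
    under eq_bigr do rewrite mulrBr.
    by rewrite sumrB -mulr_suml subr_le0.
  move/eqP: diff0; rewrite psumr_eq0; last first.
    by move=> k _; rewrite mulr_ge0// subr_ge0 wmax.
  move=> /allP /(_ j (mem_index_enum _)) /=.
  by rewrite mulf_eq0 gt_eqF ?(ae _ j).1//= subr_eq0 => /eqP.
have i0n : i0 != ord0.
  by apply: contraTneq m0 => i00; rewrite /m i00 w0 ltxx.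
have /connectP[p ep i0p] := he i0 i0n.
have wp x : path e x p -> w (last x p) = m -> w x = m.
  elim: p x {ep i0p} => [//|y p IH] x /= /andP[exy yp] wl.
  by apply: back exy _; exact: IH.
by have := wp ord0 ep; rewrite -i0p w0 => /(_ erefl) m00; rewrite -m00 ltxx in m0.
Qed.

Lemma unitmx_mulmx_inj (F : fieldType) (n : nat) (Q : 'M[F]_n) :
  (forall z : 'cV_n, Q *m z = 0 -> z = 0) -> Q \in unitmx.
Proof.
move=> Qinj; rewrite -unitmx_tr -row_free_unit -kermx_eq0; apply/eqP/row_matrixP => i.
rewrite row0; apply: trmx_inj; rewrite trmx0; apply: Qinj.
by apply: trmx_inj; rewrite trmx_mul trmxK trmx0 -row_mul mulmx_ker row0.
Qed.

(** For a row eigenvector v and w = v Q^T, the Hermitian squares satisfy |w|^2 = l |v|^2, and both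
    are positive because Q is invertible. *)
Lemma spectrum_gram_gt0 (R : realType) (n : nat) (Q : 'M[R]_n) (l : R[i]) :
  Q \in unitmx -> spectrum (Q^T *m Q) l -> 0 < complex.Re l.
Proof.
move=> Qu /eigenvalueP[v vl v0].
pose QC := map_mx (real_complex R) Q.
have QCu : QC \in unitmx by rewrite map_unitmx.
pose sq k (u : 'rV[R[i]]_k) := (u *m (map_mx (@conjc R) u)^T) 0 0.
have sqE k (u : 'rV[R[i]]_k) : sq k u = \sum_j u 0 j * conjc (u 0 j).
  by rewrite /sq mxE; apply: eq_bigr => j _; rewrite !mxE.
have sq_gt0 k (u : 'rV[R[i]]_k) : u != 0 -> 0 < sq k u.
  move=> /rV0Pn[j uj]; rewrite sqE (bigD1 j)//= ltr_pwDl//.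
    by rewrite lt_def mulcJ_ge0 mulf_neq0 ?conjc_eq0.
  by apply: sumr_ge0 => i _; exact: mulcJ_ge0.
have wn0 : v *m QC^T != 0.
  apply: contraNneq v0 => /(congr1 (mulmx^~ (invmx QC^T))).
  by rewrite mul0mx mulmxK ?unitmx_tr// => ->.
have QCconj : map_mx (@conjc R) QC = QC.
  by apply/matrixP => i j; rewrite !mxE conjc_real.
have sqw : sq _ (v *m QC^T) = l * sq _ v.
  rewrite {1}/sq map_mxM -map_trmx QCconj trmx_mul trmxK mulmxA -[v *m _ *m _]mulmxA.
  by move: vl; rewrite map_mxM -map_trmx => ->; rewrite -scalemxAl mxE.
(* In the order on [R[i]], 0 < l means that l is real and positive. *)
have : 0 < l by have := sq_gt0 _ _ wn0; rewrite sqw pmulr_lgt0// sq_gt0.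
by rewrite ltcE => /andP[].
Qed.

(** * Vectorisation of the regulator equations *)

Lemma vecK (R : realType) (n q : nat) : cancel (@vec R n q) (@unvec R n q).
Proof. by move=> A; apply/matrixP => i k; rewrite !mxE mxtens_indexK. Qed.

Lemma unvecK (R : realType) (n q : nat) : cancel (@unvec R n q) (@vec R n q).
Proof.
move=> x; apply/colP => r; rewrite !mxE -surjective_pairing mxtens_unindexK.
by congr (x r); exact: ord1.
Qed.

Lemma vecB (R : realType) (n q : nat) (A B : 'M[R]_(n, q)) :
  vec (A - B) = vec A - vec B.
Proof. by apply/colP => r; rewrite !mxE. Qed.

Lemma unvecB (R : realType) (n q : nat) (x y : 'cV[R]_(q * n)) :
  unvec (x - y) = unvec x - unvec y.
Proof. by apply/matrixP => i k; rewrite !mxE. Qed.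

(** The classical vec identity; with columns stacked, the left Kronecker factor acts on the right of
    [W], transposed. *)
Lemma tensmx_vec (R : realType) (n q : nat) (L : 'M[R]_q) (K : 'M[R]_n)
    (W : 'M[R]_(n, q)) :
  tensmx L K *m vec W = vec (K *m W *m L^T).
Proof.
apply/colP => r; rewrite -[r]mxtens_unindexK; case: (mxtens_unindex r) => k i; rewrite !mxE mxtens_indexK /=.
under [RHS]eq_bigr => k' _ do rewrite !mxE.
rewrite (reindex (@mxtens_index q n)) /=; last first.
  by exists (@mxtens_unindex q n) => x _; rewrite ?mxtens_indexK ?mxtens_unindexK.
under eq_bigr => x _ do rewrite !mxE !mxtens_indexK.
rewrite -(pair_bigA _ (fun k' i' => L k k' * K i i' * W i' k')) /=.
apply: eq_bigr => k' _; rewrite mulr_suml; apply: eq_bigr => i' _.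
by rewrite [L k k' * _]mulrC mulrAC.
Qed.

Lemma regulator_mx_vec (R : realType) (q n m : nat) (S : 'M[R]_q)
    (A : 'M[R]_n) (B : 'M[R]_(n, m)) (C : 'M[R]_(m, n)) (D : 'M[R]_m)
    (X : 'M[R]_(n, q)) (U : 'M[R]_(m, q)) :
  regulator_mx S A B C D *m vec (col_mx X U) =
  vec (col_mx (X *m S - (A *m X + B *m U)) (- (C *m X + D *m U))).
Proof.
rewrite /regulator_mx mulmxBl !tensmx_vec trmxK trmx1 mulmx1 -vecB; congr vec.
rewrite !mul_block_col !mul0mx mul1mx !addr0 mul_col_mx mul0mx.
by rewrite opp_col_mx add_col_mx add0r.
Qed.

Lemma regulator_eqsE (R : realType) (q n m : nat) (S : 'M[R]_q)
    (A : 'M[R]_n) (B : 'M[R]_(n, m)) (C : 'M[R]_(m, n)) (D : 'M[R]_m)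
    (E : 'M[R]_(n, q)) (F : 'M[R]_(m, q)) (X : 'M[R]_(n, q)) (U : 'M[R]_(m, q)) :
  regulator_eqs S A B C D E F (X, U) <->
  regulator_mx S A B C D *m vec (col_mx X U) = vec (col_mx E F).
Proof.
rewrite regulator_mx_vec /regulator_eqs /=; split.
  move=> [-> F0]; congr (vec (col_mx _ _)); first by rewrite addrC addKr.
  by apply/esym/eqP; rewrite -addr_eq0 addrC -F0.
move=> /(can_inj (@vecK R _ _))/eq_col_mx[<- <-]; split; first by rewrite addrC subrK.
by rewrite subrr.
Qed.

(** Adding a kernel vector to the vectorised solution gives another solution, so uniqueness makes
    the kernel trivial. *)
Lemma regulator_mx_unit (R : realType) (q n m : nat) (S : 'M[R]_q)
    (A : 'M[R]_n) (B : 'M[R]_(n, m)) (C : 'M[R]_(m, n)) (D : 'M[R]_m)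
    (E : 'M[R]_(n, q)) (F : 'M[R]_(m, q)) XU :
  unique (regulator_eqs S A B C D E F) XU -> regulator_mx S A B C D \in unitmx.
Proof.
case: XU => X U [/regulator_eqsE XU uniqXU]; apply: unitmx_mulmx_inj => z Qz.
pose W := unvec (vec (col_mx X U) + z).
have vW : vec (col_mx (usubmx W) (dsubmx W)) = vec (col_mx X U) + z.
  by rewrite vsubmxK unvecK.
have /uniqXU[XW UW] : regulator_eqs S A B C D E F (usubmx W, dsubmx W).
  by apply/regulator_eqsE; rewrite vW mulmxDr XU Qz addr0.
by move: vW; rewrite -XW -UW => /esym/eqP; rewrite -subr_eq0 addrC addKr => /eqP.
Qed.

(** * Convergence of the gradient iteration and of the observer *)

(* The error [e = zeta - z] obeys
   e (t + 1) = (1 - mu Q^T Q) e - mu (G^T (G - Q) (e + z) + (G - Q)^T Q e). *)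
Lemma geo_gradient_flow (R : realType) (n : nat) (Q : 'M[R]_n) (G : nat -> 'M[R]_n)
    (mu : R) (z : 'cV[R]_n) (zeta : nat -> 'cV[R]_n) :
  Q \in unitmx -> 0 < mu < 2 / rho (Q^T *m Q) ->
  geo_bounded (fun t => `|G t - Q|) ->
  (forall t, zeta t.+1 = zeta t - mu *: ((G t)^T *m (G t *m zeta t - Q *m z))) ->
  geo_bounded (fun t => `|zeta t - z|).
Proof.
move=> Qu hmu gG zrec; have mu0 : 0 < mu by case/andP: hmu.
pose e t := zeta t - z; pose g t := `|G t - Q|.
have [L [L0 QL GL]] : exists L, [/\ 0 <= L, `|Q| <= L & forall t, `|G t| <= L].
  case: gG => c [r [c0 /andP[r0 r1] gb]]; exists (c + `|Q|); split.
  - by rewrite addr_ge0// ltW.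
  - by rewrite lerDr ltW.
  move=> t; rewrite -[G t](subrK Q) (le_trans (ler_normD _ _))// lerD2r.
  by rewrite (le_trans (gb t))// ler_piMr ?exprn_ile1 ?ltW.
have g0 t : 0 <= g t by exact: normr_ge0.
pose f t := - (mu *: ((G t)^T *m ((G t - Q) *m zeta t) + (G t - Q)^T *m (Q *m e t))).
(* Two matrix products cost n^2; the two terms of f add up to 2|e| + |z| <= (2 + |z|)(|e| + 1). *)
pose K := mu * (n%:R * n%:R * L) * (2 + `|z|).
have K0 : 0 <= K by rewrite !mulr_ge0 ?addr_ge0// ltW.
apply: (geo_perturbed (M := 1 - mu *: (Q^T *m Q)) (f := f) (phi := fun t => K * g t)).
- by move=> i j; apply: geo_gradient_power => // l; exact: spectrum_gram_gt0.
- exact: geo_scale.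
- by move=> t; rewrite mulr_ge0.
- move=> t; rewrite /f /e mulmxBl mul1mx -scalemxAl -addrA -opprD -scalerDr zrec addrAC.
  congr (_ - _ *: _).
  rewrite -mulmxA addrCA [(G t - Q)^T]linearB /= [(_ - _) *m (Q *m _)]mulmxBl [Q^T *m _ + _]addrC subrK -mulmxDr.
  by congr (_ *m _); rewrite mulmxBl mulmxBr addrA subrK.
move=> t; rewrite normrN normrZ gtr0_norm// /K -!mulrA ler_wpM2l ?(ltW mu0)//.
have e0 : 0 <= `|e t| by exact: normr_ge0.
have zt : `|zeta t| <= `|e t| + `|z| by rewrite -[zeta t](subrK z) ler_normD.
have n2 : 0 <= n%:R * n%:R :> R by rewrite mulr_ge0.
have b1 : `|(G t)^T *m ((G t - Q) *m zeta t)| <= n%:R * n%:R * (L * g t * (`|e t| + `|z|)).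
  apply: (le_trans (mx_normM _ _)); rewrite -mulrA ler_wpM2l// -mulrA mulrCA.
  apply: ler_pM => //; first exact: le_trans (mx_norm_tr _) (GL t).
  by apply: (le_trans (mx_normM _ _)); rewrite ler_wpM2l// ler_wpM2l.
have b2 : `|(G t - Q)^T *m (Q *m e t)| <= n%:R * n%:R * (L * g t * `|e t|).
  apply: (le_trans (mx_normM _ _)); rewrite -mulrA ler_wpM2l// [L * _]mulrC -mulrA mulrCA.
  apply: ler_pM => //; first exact: mx_norm_tr.
  by apply: (le_trans (mx_normM _ _)); rewrite ler_wpM2l// ler_wpM2r.
apply: (le_trans (ler_normD _ _)); apply: (le_trans (lerD b1 b2)).
rewrite -mulrDr -[leLHS]mulrA; do 2 (apply: ler_wpM2l => //).
rewrite -mulrDr -[leLHS]mulrA ler_wpM2l// [leRHS]mulrCA ler_wpM2l//.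
have := normr_ge0 z; nra.
Qed.

(** The recursion does not mix entries of the matrices: for fixed (r, s) the errors of the followers
    form a vector x with x(t+1) = (1 - mu H) x(t), the leader's error being 0. *)
Lemma geo_observer (R : realType) (N q : nat) (e : rel 'I_N.+1) (a : 'M[R]_N.+1)
    (mu : R) (S : 'M[R]_q) (St : 'I_N.+1 -> nat -> 'M[R]_q) (i : 'I_N) :
  weighted_adjacency e a -> has_spanning_tree0 e -> 0 < mu < 2 / rho (Hmx a) ->
  (forall t, St ord0 t = S) ->
  (forall (i : 'I_N) (t : nat), St (lift ord0 i) t.+1 = St (lift ord0 i) t +
      mu *: \sum_(j < N.+1) a (lift ord0 i) j *: (St j t - St (lift ord0 i) t)) ->
  geo_bounded (fun t => `|St (lift ord0 i) t - S|).
Proof.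
move=> ha he hmu St0 Strec; apply: geo_mx_norm => r s.
pose x t : 'cV[R]_N := \col_k (St (lift ord0 k) t - S) r s.
have xrec t : x t.+1 = (1 - mu *: Hmx a) *m x t.
  rewrite mulmxBl mul1mx -scalemxAl; apply/colP => k.
  rewrite !mxE Strec !mxE summxE addrAC -!mulrN; congr (_ + _ * _).
  rewrite (bigD1 k)//= !mxE eqxx big_ord_recl !mxE St0.
  have -> : \sum_(j < N | j != k) Hmx a k j * x t j 0 =
      \sum_(j < N) - (a (lift ord0 k) (lift ord0 j) * x t j 0).
    rewrite [RHS](bigD1 k)//= ha.1 mul0r oppr0 add0r; apply: eq_bigr => j jk.
    by rewrite !mxE eq_sym (negPf jk) mulNr.
  rewrite sumrN opprB big_ord_recl.
  have -> : \sum_(j < N) (a (lift ord0 k) (lift ord0 j) *: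
      (St (lift ord0 j) t - St (lift ord0 k) t)) r s =
    \sum_(j < N) a (lift ord0 k) (lift ord0 j) * x t j 0 -
    (\sum_(j < N) a (lift ord0 k) (lift ord0 j)) * x t k 0.
    rewrite mulr_suml -sumrB; apply: eq_bigr => j _; rewrite !mxE; ring.
  rewrite !mxE; ring.
have xE t : x t = (1 - mu *: Hmx a) ^+ t *m x 0%N.
  elim: t => [|t IH]; first by rewrite expr0 mul1mx.
  by rewrite xrec IH exprS mulmxA.
apply: geo_le (geo_sum (index_enum 'I_N) (F := fun k t =>
  `|x 0%N k 0| * `|((1 - mu *: Hmx a) ^+ t) i k|) _) => [t|k].
  have -> : (St (lift ord0 i) t - S) r s = x t i 0 by rewrite [RHS]mxE.
  rewrite xE mxE (le_trans (ler_norm_sum _ _ _))// ler_sum// => k _.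
  by rewrite normrM mulrC.
apply: geo_scale => //; apply: geo_gradient_power => // l.
exact: spectrum_Hmx_gt0 ha he.
Qed.

(** The plant blocks cancel, leaving the Kronecker product of the transposed observer error with a
    fixed matrix. *)
Lemma geo_regulator_mx (R : realType) (q n m : nat) (S : 'M[R]_q) (St : nat -> 'M[R]_q)
    (A : 'M[R]_n) (B : 'M[R]_(n, m)) (C : 'M[R]_(m, n)) (D : 'M[R]_m) :
  geo_bounded (fun t => `|St t - S|) ->
  geo_bounded (fun t => `|regulator_mx (St t) A B C D - regulator_mx S A B C D|).
Proof.
pose J : 'M[R]_(n + m) := block_mx 1%:M 0 0 0.
move=> /(geo_scale (normr_ge0 J)); apply: geo_le => t.
have -> : regulator_mx (St t) A B C D - regulator_mx S A B C D =
    tensmx (St t - S)^T J.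
  rewrite /regulator_mx opprB addrA subrK -/J; move: J => J.
  by apply/matrixP => i j; rewrite !mxE mulrBl.
rewrite mulrC; apply: (le_trans (mx_norm_tens _ _)).
by rewrite ler_wpM2r// mx_norm_tr.
Qed.

Lemma unvec_norm (R : realType) (n q : nat) (x : 'cV[R]_(q * n)) : `|unvec x| <= `|x|.
Proof. by apply: mx_norm_le => // i k; rewrite mxE entry_le_mx_norm. Qed.

Unset Implicit Arguments.

Theorem lemma4 (R : realType) (N q : nat) (n m : 'I_N -> nat)
  (S : 'M[R]_q)
  (A : forall i : 'I_N, 'M[R]_(n i))
  (B : forall i : 'I_N, 'M[R]_(n i, m i))
  (C : forall i : 'I_N, 'M[R]_(m i, n i))
  (D : forall i : 'I_N, 'M[R]_(m i))
  (E : forall i : 'I_N, 'M[R]_(n i, q))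
  (F : forall i : 'I_N, 'M[R]_(m i, q))
  (X : forall i : 'I_N, 'M[R]_(n i, q))
  (U : forall i : 'I_N, 'M[R]_(m i, q))
  (hXU : forall i : 'I_N,
    unique (regulator_eqs S (A i) (B i) (C i) (D i) (E i) (F i)) (X i, U i))
  (e : rel 'I_N.+1) (a : 'M[R]_N.+1)
  (ha : weighted_adjacency e a)
  (he : has_spanning_tree0 e)
  (mu1 : R) (hmu1 : 0 < mu1 < 2 / rho (Hmx a))
  (St : 'I_N.+1 -> nat -> 'M[R]_q)
  (hSt0 : forall t : nat, St ord0 t = S)
  (hSt : forall (i : 'I_N) (t : nat),
    St (lift ord0 i) t.+1 =
      St (lift ord0 i) t +
      mu1 *: \sum_(j < N.+1) a (lift ord0 i) j *: (St j t - St (lift ord0 i) t)) :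
  forall (i : 'I_N) (mu3 : R) (zeta0 : 'cV[R]_(q * (n i + m i))),
    let b := vec (col_mx (E i) (F i)) in
    let Q := regulator_mx S (A i) (B i) (C i) (D i) in
    let G := fun t : nat =>
      regulator_mx (St (lift ord0 i) t) (A i) (B i) (C i) (D i) in
    let solution := fun zeta : nat -> 'cV[R]_(q * (n i + m i)) =>
      zeta 0%N = zeta0 /\
      forall t : nat,
        zeta t.+1 = zeta t - mu3 *: ((G t)^T *m (G t *m zeta t - b)) in
    0 < mu3 < 2 / rho (Q^T *m Q) ->
    (exists zeta : nat -> 'cV[R]_(q * (n i + m i)),
       solution zeta /\ bounded_fun zeta) /\
    (forall zeta : nat -> 'cV[R]_(q * (n i + m i)),
       solution zeta ->
       exp_cvg0 (fun t : nat => unvec (zeta t) - col_mx (X i) (U i))).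
Proof.
move=> i mu3 zeta0 b Q G solution hmu3.
have Qu : Q \in unitmx by exact: regulator_mx_unit (hXU i).
pose z := vec (col_mx (X i) (U i)).
have Qz : Q *m z = b by apply/regulator_eqsE; exact: (hXU i).1.
have geo_zeta zeta : solution zeta -> geo_bounded (fun t => `|zeta t - z|).
  move=> [_ zrec]; apply: (geo_gradient_flow (G := G) Qu hmu3).
    apply: geo_regulator_mx; exact: geo_observer ha he hmu1 hSt0 hSt.
  by move=> t; rewrite Qz zrec.
split; last first.
  (* Unstacking does not increase the max-entry norm. *)
  move=> zeta /geo_zeta gz; apply: geo_cvg0; apply: geo_le gz => t.
  by rewrite -[col_mx _ _](@vecK R) -unvecB unvec_norm.
pose zeta := fix zeta t := if t is s.+1
  then zeta s - mu3 *: ((G s)^T *m (G s *m zeta s - b)) else zeta0.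
have zsol : solution zeta by [].
(* The recursively defined solution converges to z, hence is bounded. *)
exists zeta; split=> //; apply: cvg_seq_bounded; apply/cvg_ex; exists z.
apply/subr_cvg0; exact: (geo_cvg0 (geo_zeta _ zsol)).1.
Qed.
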